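(* Let $m\ge2$, let $(\Sigma_m,\sigma)=(\{1,\dots,m\}^{\mathbb N},\sigma)$ be the one-sided full shift, and consider the order scaling $\mathrm{scl}_\alpha(t)=e^{-(\log\frac1t)^\alpha}$, $t\in(0,1)$. Then $$\overline h^C_{\mathrm{scl}}(\sigma,\Sigma_m)=\overline h^C_{\mathrm{scl}}(\sigma_*,\mathscr M(\Sigma_m))=1.$$ In particular, the induced system $(\mathscr M(\Sigma_m),\sigma_* )$ has a finite positive upper capacity entropy scale.
   Context: $\mathscr M(X)$ is the space of Borel probability measures on a compact metrizable space $X$ with the weak-$*$ topology, and for continuous $T:X\to X$, $T_*\mu=\mu\circ T^{-1}$. Upper capacity entropy scale of a continuous self-map $T$ of a compact metric space $(X,d)$ (independent of the compatible metric): with $d_n(x,y)=\max_{0\le j<n}d(T^jx,T^jy)$, let $s_n(X,\epsilon)$ be the maximal cardinality of a set $F\subset X$ with $d_n(x,y)\ge\epsilon$ for all distinct $x,y\in F$; $\overline\Lambda_{\mathrm{scl}_\alpha}(T,X)=\lim_{\epsilon\to0}\limsup_{n\to\infty}s_n(X,\epsilon)\,\mathrm{scl}_\alpha(e^{-n})$; $\overline h^C_{\mathrm{scl}}(T,X)=\inf\{\alpha>0:\overline\Lambda_{\mathrm{scl}_\alpha}(T,X)=0\}=\sup\{\alpha>0:\overline\Lambda_{\mathrm{scl}_\alpha}(T,X)=\infty\}$ (the two agree; $\sup\emptyset=0$, $\inf\emptyset=+\infty$). *)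

(* Defs.v *)
From HB Require Import structures.
From mathcomp Require Import all_boot all_order all_algebra finmap.
From mathcomp Require Import all_classical all_reals all_analysis.

Set Implicit Arguments.
Unset Strict Implicit.
Unset Printing Implicit Defensive.
Import Order.TTheory GRing.Theory Num.Theory.
Import numFieldNormedType.Exports.
Local Open Scope classical_set_scope.
Local Open Scope ring_scope.

(** * Entropy scale *)

Definition compatible_metric (R : realType) (X : topologicalType)
    (d : X -> X -> R) : Prop :=
  [/\ forall x y, d x y = 0 <-> x = y,
      forall x y, d x y = d y x,
      forall x y z, d x z <= d x y + d y z &
      forall x, nbhs x = filter_from [set e | 0 < e] (fun e => [set y | d x y < e])].

Section entropy_scale.
Context (R : realType) (X : choiceType).
Variables (d : X -> X -> R) (T : X -> X).

Definition bowen_dist (n : nat) (x y : X) : R :=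
  \big[Num.max/0]_(j < n) d (iter j T x) (iter j T y).

Definition bowen_separated (n : nat) (e : R) (F : {fset X}) : Prop :=
  {in F &, forall x y, x != y -> e <= bowen_dist n x y}.

(* A maximum whenever it is finite, as it is on a compact space. *)
Definition max_separated (n : nat) (e : R) : \bar R :=
  ereal_sup [set (#|` F|%:R)%:E | F in bowen_separated n e].

Variable scl : R -> R -> R.

(* The limit exists, the expression being nonincreasing in [e]. *)
Definition upper_capacity_at (a : R) : \bar R :=
  lim (limn_esup (fun n => max_separated n e * (scl a (expR (- n%:R)))%:E)%E
       @[e --> 0^'+]).

Definition upper_capacity_scale : \bar R :=
  ereal_inf [set a%:E | a in [set a | 0 < a /\ upper_capacity_at a = 0%E]].

End entropy_scale.

Definition order_scl (R : realType) (a t : R) : R := expR (- (ln t^-1 `^ a)).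

(** * Borel probability measures *)

Definition borel (X : ptopologicalType) := g_sigma_algebraType (@open X).

(* A library measure is a function on all sets, with no constraint on its
   values off the sigma-algebra. Requiring these values to be 0 makes Leibniz
   equality in [borel_probability] the equality of Borel measures; otherwise
   the weak-* topology would not be Hausdorff. *)
Definition borel_probability (R : realType) (X : ptopologicalType) : Type :=
  {P : probability (borel X) R | forall A, ~ measurable A -> P A = 0%E}.

HB.instance Definition _ (R : realType) (X : ptopologicalType) :=
  gen_eqMixin (borel_probability R X).
HB.instance Definition _ (R : realType) (X : ptopologicalType) :=
  gen_choiceMixin (borel_probability R X).

Definition integration (R : realType) (X : ptopologicalType)
    (P : borel_probability R X) :
    prod_topology (fun _ : continuousType X R => R) :=
  fun f => \int[sval P]_x f x.

(* The weak-* topology: the coarsest one for which integration against each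
   continuous real function is continuous. *)
HB.instance Definition _ (R : realType) (X : ptopologicalType) :=
  Topological.copy (borel_probability R X)
    (initial_topology (@integration R X)).

Section borel_restriction.
Context (R : realType) (X : ptopologicalType) (P : probability (borel X) R).
Local Open Scope ereal_scope.

Definition borel_restr (A : set (borel X)) : \bar R :=
  if `[< measurable A >] then P A else 0.

Lemma borel_restrE A : measurable A -> borel_restr A = P A.
Proof. by rewrite /borel_restr => /asboolT ->. Qed.

Let borel_restr0 : borel_restr set0 = 0.
Proof. by rewrite borel_restrE ?measure0//; exact: measurable0. Qed.

Let borel_restr_ge0 A : 0 <= borel_restr A.
Proof. by rewrite /borel_restr; case: ifP. Qed.

Let borel_restr_sigma_additive : semi_sigma_additive borel_restr.
Proof.
move=> F mF tF mUF; rewrite borel_restrE//.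
under eq_fun do under eq_bigr do rewrite borel_restrE//.
exact: measure_semi_sigma_additive.
Qed.

HB.instance Definition _ := isMeasure.Build _ _ _ borel_restr
  borel_restr0 borel_restr_ge0 borel_restr_sigma_additive.

Let borel_restrT : borel_restr setT = 1.
Proof. by rewrite borel_restrE ?probability_setT. Qed.

HB.instance Definition _ := Measure_isProbability.Build _ _ _ borel_restr
  borel_restrT.

Lemma borel_restrN A : ~ measurable A -> borel_restr A = 0.
Proof. by rewrite /borel_restr => /asboolF ->. Qed.

Definition to_borel_probability : borel_probability R X :=
  exist _ (borel_restr : probability (borel X) R) borel_restrN.

End borel_restriction.

Section image_measure.
Context (R : realType) (X : ptopologicalType) (T : continuousType X X).

Definition borel_map : borel X -> borel X := T.

Lemma borel_map_measurable : measurable_fun setT borel_map.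
Proof.
apply: (@measurability _ _ _ _ setT borel_map (@open X)) => //.
move=> _ [B oB <-]; rewrite setTI; apply: sub_sigma_algebra.
by apply: open_comp => // x _; exact: cts_fun.
Qed.

HB.instance Definition _ :=
  isMeasurableFun.Build _ _ _ _ borel_map borel_map_measurable.

Definition image_measure (P : borel_probability R X) : borel_probability R X :=
  to_borel_probability (distribution (sval P) borel_map).

Lemma image_measureE (P : borel_probability R X) (A : set (borel X)) :
  measurable A -> sval (image_measure P) A = sval P (T @^-1` A).
Proof. by move=> mA; rewrite /= borel_restrE. Qed.

End image_measure.

(** * The one-sided full shift *)

(* The symbols are 0, ..., m - 1. The proof of [1 < m] provides the point
   that measurable types need. *)
Definition alphabet (m : nat) (m_gt1 : (1 < m)%N) : Type := 'I_m.

Section full_shift.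
Context (m : nat) (m_gt1 : (1 < m)%N).

HB.instance Definition _ := Finite.copy (alphabet m_gt1) 'I_m.
HB.instance Definition _ :=
  isPointed.Build (alphabet m_gt1) (Ordinal (ltnW m_gt1)).

Definition full_shift : Type :=
  prod_topology (fun _ : nat => discrete_topology (alphabet m_gt1)).

HB.instance Definition _ := Pointed.on full_shift.
HB.instance Definition _ := Topological.on full_shift.

Definition left_shift (x : full_shift) : full_shift := fun i => x i.+1.

Lemma left_shift_continuous : continuous left_shift.
Proof.
pose A := discrete_topology (alphabet m_gt1).
have shiftP (i : nat) (B : set A) : open B ->
    open ((fun x : full_shift => x i.+1) @^-1` B).
  move=> oB; apply: open_comp oB => x _.
  exact: (@proj_continuous nat (fun=> A) i.+1).
move=> x; have F : Filter (left_shift @ nbhs x) by exact: fmap_filter.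
apply: (proj2 (@cvg_sup _ _ (fun i : nat => Topological.class
  (initial_topology (fun f : full_shift => f i : A))) _ (left_shift x) F)).
move=> i U [_ [[B oB <-] Bx BU]].
apply: filterS BU _; apply: open_nbhs_nbhs; split => //.
exact: shiftP.
Qed.

HB.instance Definition _ := isContinuous.Build _ _ left_shift left_shift_continuous.

End full_shift.

(* Main.v *)
(* Both systems have, at each fixed scale [e], exponentially many [n]-separated
   points, and [scl_a (exp (- n)) = exp (- n ^ a)] is superexponentially small for
   [a > 1] and subexponential for [a < 1]; so the scale is 1. In the induced
   system the exponential rate is unbounded as [e] tends to 0, which the order
   scaling does not see.

   Upper bound: a measure is determined up to [e] by a code in a finite set [K],
   so an orbit segment of length [n] has at most [#|K| ^ n] codes. This rests on
   compactness of the space of measures, in the form: along an ultrafilter, the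
   measures of clopen sets converge to a finitely additive set function, which is
   sigma-additive on clopen sets by compactness of the shift and extends to a
   Borel probability measure by Caratheodory's theorem.

   Lower bound: points with distinct first symbols are uniformly separated, also
   after embedding the shift equivariantly as Dirac measures, so the [m ^ n] words
   of length [n] give an [n]-separated set. *)

Require Import Defs.
From HB Require Import structures.
From mathcomp Require Import all_boot all_order all_algebra finmap.
From mathcomp Require Import all_classical all_reals all_analysis.
From mathcomp Require Import lra.
Set Implicit Arguments.
Unset Strict Implicit.
Unset Printing Implicit Defensive.
Import Order.TTheory GRing.Theory Num.Theory.
Import numFieldNormedType.Exports.
Local Open Scope classical_set_scope.
Local Open Scope ring_scope.

(** * Extension of contents on clopen sets *)

Definition clopen_algebra (X : ptopologicalType) : Type := X.

Fact clopen_display : measure_display. Proof. exact: default_measure_display. Qed.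

HB.instance Definition _ (X : ptopologicalType) :=
  Pointed.on (clopen_algebra X).

HB.instance Definition _ (X : ptopologicalType) :=
  @isAlgebraOfSets.Build clopen_display (clopen_algebra X) (@clopen X)
    clopen0 clopenU (fun A => @clopenC X A A).

(** A clopen union is compact, so finitely many [F i] cover it; by disjointness the others are
    empty. *)
Lemma compact_trivIset_clopen (X : ptopologicalType) (F : (set X)^nat) :
  compact [set: X] -> (forall i, clopen (F i)) -> trivIset setT F ->
  clopen (\bigcup_i F i) -> exists N, forall i, (N <= i)%N -> F i = set0.
Proof.
move=> cX cF tF [_ clF].
have : compact (\bigcup_i F i) by exact: (subclosed_compact clF cX).
rewrite compact_cover => /(_ _ setT F) [].
- by move=> i _; have [] := cF i.
- by [].
move=> D _ FD.
exists (\max_(i <- D) i).+1 => i Di; apply/seteqP; split => // x Fix.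
have [j /= jD Fjx] : (\bigcup_(i in [set` D]) F i) x by apply: FD; exists i.
have ij : i = j by apply: (tF i j) => //; exists x.
by move: Di; rewrite ij ltnNge => /negP[]; exact: leq_bigmax_seq.
Qed.

(** A disjoint clopen union that is clopen is finite by compactness, so finite additivity already
    gives a premeasure, which Caratheodory's theorem extends. *)
Lemma clopen_content_extension (R : realType) (X : ptopologicalType)
    (nu : set X -> R) :
  compact [set: X] -> @open X `<=` <<s @clopen X >> ->
  (forall A, 0 <= nu A) -> nu setT = 1 ->
  (forall A B, clopen A -> clopen B -> A `&` B = set0 ->
    nu (A `|` B) = nu A + nu B) ->
  exists P : borel_probability R X, forall A, clopen A -> sval P A = (nu A)%:E.
Proof.
move=> cX oX nu_ge0 nuT nuU.
have nu0 : nu set0 = 0.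
  have := nuU _ _ clopen0 clopen0 (set0I _); rewrite set0U => /eqP.
  by rewrite -subr_eq0 opprD addNKr oppr_eq0 => /eqP.
pose mu (A : set (clopen_algebra X)) := (nu A)%:E.
have mu0 : mu set0 = 0%E by rewrite /mu nu0.
have mu_ge0 A : (0 <= mu A)%E by rewrite lee_fin.
have mu_sigma : semi_sigma_additive mu.
  move=> F mF tF mUF.
  have [N FN] := compact_trivIset_clopen cX mF tF mUF.
  have addF n : (\sum_(0 <= i < n) mu (F i) = mu (\big[setU/set0]_(i < n) F i))%E.
    elim: n => [|n IH]; first by rewrite big_nil big_ord0 mu0.
    rewrite big_nat_recr//= IH big_ord_recr /= /mu nuU//.
    - exact: (bigsetU_measurable (T := clopen_algebra X)).
    - exact: mF.
    - rewrite -bigcup_mkord; apply/seteqP; split => // x [[i /= ni Fix] Fnx].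
      by move: ni; rewrite (tF i n I I (ex_intro _ x (conj Fix Fnx))) ltnn.
  apply: cvg_near_cst.
  exists N => // n /= Nn; rewrite addF; congr mu.
  apply/seteqP; split => x; first by rewrite -bigcup_mkord => -[i _ Fix]; exists i.
  move=> [i _ Fix]; rewrite -bigcup_mkord; exists i => //=.
  by rewrite ltnNge; apply: contraPN Fix => /(leq_trans Nn)/FN ->.
pose Mu : {measure set (clopen_algebra X) -> \bar R} :=
  HB.pack_for {measure set (clopen_algebra X) -> \bar R} mu
    (isMeasure.Build _ _ _ mu mu0 mu_ge0 mu_sigma).
have MuE A : clopen A -> measure_extension Mu A = (nu A)%:E.
  by move=> cA; rewrite /measure_extension measurable_mu_extE.
(* The extension lives on the sigma-algebra generated by the clopen sets; this inclusion restricts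
   it to Borel sets. *)
have mX A : measurable (A : set (borel X)) ->
    measurable (A : set (g_sigma_algebraType (@clopen X))).
  apply: smallest_sub => //; exact: smallest_sigma_algebra.
pose P (A : set (borel X)) := measure_extension Mu A.
have P0 : P set0 = 0%E by exact: measure0.
have P_ge0 A : (0 <= P A)%E by exact: measure_ge0.
have P_sigma : semi_sigma_additive P.
  move=> F mF tF mUF.
  apply: (@measure_semi_sigma_additive _ _ _ (measure_extension Mu)) => //.
  - by move=> i; exact: mX.
  - exact: mX.
have PT : P setT = 1%E by rewrite /P MuE ?nuT//; exact: clopenT.
pose PM : {measure set (borel X) -> \bar R} :=
  HB.pack_for {measure set (borel X) -> \bar R} P
    (isMeasure.Build _ _ _ P P0 P_ge0 P_sigma).
pose Pr : probability (borel X) R :=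
  HB.pack_for (probability (borel X) R) P
    (isMeasure.Build _ _ _ P P0 P_ge0 P_sigma)
    (Measure_isProbability.Build _ _ _ PM PT).
exists (to_borel_probability Pr) => A cA.
rewrite /= borel_restrE; first exact: MuE.
by apply: sub_sigma_algebra; have [] := cA.
Qed.

(** * Convergence and the full shift *)

(** A cluster point of an ultrafilter is a limit: if the preimage of a neighbourhood were not in
    [U], its complement would be. *)
Lemma ultra_compact_cvg (I : Type) (U : set_system I) (X : topologicalType)
    (K : set X) (x : I -> X) :
  UltraFilter U -> compact K -> (forall i, K (x i)) ->
  exists2 z, K z & x @ U --> z.
Proof.
move=> UU cK Kx; have [|z [Kz clz]] := cK (x @ U) _.
  by apply: (filterS (F := U)) filterT => i _; exact: Kx.
exists z => // A zA; have [//|UA] := in_ultra_setVsetC (x @^-1` A) UU.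
by have [y []] := clz _ _ (UA : (x @ U) (~` A)) zA.
Qed.

Lemma cvg_initial (S : choiceType) (T : topologicalType) (f : S -> T)
    (F : set_system S) (s : S) :
  Filter F -> f @ F --> f s -> F --> (s : initial_topology f).
Proof.
move=> FF fFs A [_ [[B oB <-] Bs BA]].
by apply: filterS BA _; apply: fFs; exact: open_nbhs_nbhs.
Qed.

Lemma weak_cvg (R : realType) (X : ptopologicalType) (I : Type)
    (F : set_system I) (P : I -> borel_probability R X)
    (Q : borel_probability R X) :
  Filter F ->
  (forall f : continuousType X R,
    \int[sval (P i)]_x f x @[i --> F] --> \int[sval Q]_x f x) ->
  P @ F --> Q.
Proof.
move=> FF cvF; apply: (@cvg_initial _ _ (@integration R X)).
apply/cvg_sup => f; apply: cvg_initial; exact: cvF.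
Qed.

Lemma integration_continuous (R : realType) (X : ptopologicalType)
    (f : continuousType X R) :
  continuous (fun P : borel_probability R X => \int[sval P]_x f x).
Proof.
move=> P; apply: (@continuous_comp _ _ _ (@integration R X) (proj f)).
  exact: initial_continuous.
exact: proj_continuous.
Qed.

Section full_shift_topology.
Context (m : nat) (m_gt1 : (1 < m)%N).
Local Notation X := (full_shift m_gt1).

Definition initial_word (L : nat) (x : X) : {ffun 'I_L -> alphabet m_gt1} :=
  [ffun i : 'I_L => x i].

Lemma prefix_eqP (L : nat) (x y : X) :
  initial_word L x = initial_word L y <-> forall i, (i < L)%N -> x i = y i.
Proof.
split=> [xy i iL|xy]; last by apply/ffunP => i; rewrite !ffunE xy.
by move/ffunP : xy => /(_ (Ordinal iL)); rewrite !ffunE.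
Qed.

Lemma full_shift_compact : compact [set: X].
Proof.
have -> : [set: X] = [set f : X | forall i, setT (f i)].
  by apply/seteqP; split.
apply: (@tychonoff nat (fun=> discrete_topology (alphabet m_gt1)) (fun=> setT)).
by move=> _; apply: finite_compact; exact: finite_finset.
Qed.

Lemma near_coord (x : X) (i : nat) : \forall y \near x, y i = x i.
Proof.
apply: (@proj_continuous nat (fun=> discrete_topology (alphabet m_gt1)) i x
  [set x i]).
exact/discrete_set1.
Qed.

Lemma near_prefix (x : X) (L : nat) :
  \forall y \near x, initial_word L y = initial_word L x.
Proof.
have xFilter : Filter (nbhs x) by exact: nbhs_filter.
have : nbhs x [set y | forall i : 'I_L, y i = x i].
  exact: (@filter_forall X 'I_L (fun i => [set y | y i = x i]) (nbhs x) xFilter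
    (fun i => near_coord x i)).
by apply: filterS => y yx; apply/ffunP => i; rewrite !ffunE yx.
Qed.

Lemma clopen_prefix (L : nat) (S : set {ffun 'I_L -> alphabet m_gt1}) :
  clopen (initial_word L @^-1` S).
Proof.
have oprefix B : open (initial_word L @^-1` B).
  rewrite openE => x Bx; apply: filterS (near_prefix x L) => y yx.
  by rewrite /= yx.
split; first exact: oprefix.
have -> : initial_word L @^-1` S = ~` (initial_word L @^-1` (~` S)).
  by rewrite preimage_setC setCK.
exact: open_closedC.
Qed.

Lemma full_shift_cvg (I : Type) (F : set_system I) (x : I -> X) (z : X) :
  Filter F -> (forall i, \forall k \near F, x k i = z i) -> x @ F --> z.
Proof.
move=> FF xz; apply/cvg_sup => i; apply: cvg_initial; apply/discrete_cvg.
exact: xz.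
Qed.

(** Otherwise points outside [O] sharing ever longer prefixes with [x] would converge to [x]. *)
Lemma open_prefix (O : set X) (x : X) : open O -> O x ->
  exists L, initial_word L @^-1` [set initial_word L x] `<=` O.
Proof.
move=> oO Ox; apply: contrapT => /forallNP nO.
have /choice[y yP] L : exists y, initial_word L y = initial_word L x /\ ~ O y.
  by have /existsNP[y /not_implyP[? ?]] := nO L; exists y.
have yx : y @ \oo --> x.
  apply: full_shift_cvg => i; exists i.+1 => // L /= iL.
  by have [/prefix_eqP -> ] := yP L.
have /(yx O)[L _ /(_ L (leqnn L))] : nbhs x O by exact: open_nbhs_nbhs.
by have [] := yP L.
Qed.

Lemma full_shift_open_sigma : @open X `<=` <<s @clopen X >>.
Proof.
move=> O oO.
pose J := {L : nat & {ffun 'I_L -> alphabet m_gt1}}.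
(* [C j] is the cylinder of a word if it lies in [O], and empty otherwise; there are countably many
   words. *)
pose C (j : J) : set (g_sigma_algebraType (@clopen X)) :=
  initial_word (tag j) @^-1` [set w | w = tagged j /\ initial_word (tag j) @^-1` [set w] `<=` O].
have -> : O = \bigcup_j C j.
  apply/seteqP; split=> [x Ox|x [[L w] _ [xw wO]]]; last exact: wO.
  have [L LO] := open_prefix oO Ox.
  by exists (Tagged (fun L => {ffun 'I_L -> alphabet m_gt1}) (initial_word L x)).
apply: (@countable_bigcupT_measurable _
  (g_sigma_algebraType (@clopen X)) J C) => [|j]; first exact: countableP.
by apply: (@sub_sigma_algebra X setT); exact: clopen_prefix.
Qed.

End full_shift_topology.

(** * Compactness through finite codes *)

(* Compactness in contrapositive form: if codes of every level failed to control
   [rho], an ultralimit of the counterexamples would violate continuity. *)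
Lemma ultra_code_uniform (R : realType) (X : topologicalType)
    (K : nat -> Type) (c : forall L, X -> K L) (rho : X -> X -> R) :
  (forall (U : set_system nat) (x y : nat -> X), UltraFilter U ->
    \oo `<=` U -> (forall L, c L (x L) = c L (y L)) ->
    exists z : X, x @ U --> z /\ y @ U --> z) ->
  (forall x y, rho x y = rho y x) ->
  (forall x y z, rho x z <= rho x y + rho y z) ->
  (forall x e, 0 < e -> \forall y \near x, rho x y < e) ->
  forall e, 0 < e -> exists L, forall x y, c L x = c L y -> rho x y < e.
Proof.
move=> cP rhoC rhoD rhoN e e0; apply: contrapT => /forallNP nL.
have /choice[xy xyP] L :
    exists xy, c L xy.1 = c L xy.2 /\ e <= rho xy.1 xy.2.
  have /existsNP[x /existsNP[y /not_implyP[cxy /negP]]] := nL L.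
  by rewrite -leNgt => exy; exists (x, y).
have [U [UU ooU]] := ultraFilterLemma (eventually_filter).
have [z [xz yz]] := cP U (fst \o xy) (snd \o xy) UU ooU (fun L => (xyP L).1).
have e2 : 0 < e / 2 by rewrite divr_gt0.
have Ux : U [set L | rho z (xy L).1 < e / 2] by exact: xz (rhoN z _ e2).
have Uy : U [set L | rho z (xy L).2 < e / 2] by exact: yz (rhoN z _ e2).
have [L [/= xL yL]] := filter_ex (filterI Ux Uy).
have := le_lt_trans (rhoD (xy L).1 z (xy L).2) (ltrD _ yL).
by rewrite rhoC => /(_ _ xL); rewrite -splitr ltNge (xyP L).2.
Qed.

Lemma continuous_borel_measurable (R : realType) (X : ptopologicalType)
    (f : X -> R) :
  continuous f -> measurable_fun setT (f : borel X -> R).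
Proof.
move=> /continuousP cf; apply: (measurability _ (measurable_realfun.RGenOpens.measurableE R)).
move=> _ [_ [a [b ->] <-]]; rewrite setTI; apply: sub_sigma_algebra.
exact/cf/interval_open.
Qed.

Lemma continuous_borel_integrable (R : realType) (X : ptopologicalType)
    (P : probability (borel X) R) (f : X -> R) :
  compact [set: X] -> continuous f -> P.-integrable setT (EFin \o f).
Proof.
move=> cX cf; apply: measurable_bounded_integrable => //.
- by apply: le_lt_trans (probability_le1 P measurableT) _; exact: ltry.
- exact: continuous_borel_measurable.
- have /compact_bounded[M [Mr fM]] : compact (f @` setT).
    by apply: continuous_compact => //; exact: continuous_subspaceT.
  by exists M; split => // N MN x _; apply: (fM N) => //; exists x.
Qed.

Lemma Rintegral_sum (d : measure_display) (T : measurableType d) (R : realType)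
    (mu : {measure set T -> \bar R}) (D : set T) (I : Type) (s : seq I)
    (h : I -> T -> R) :
  measurable D -> (forall i, mu.-integrable D (EFin \o h i)) ->
  \int[mu]_(x in D) (\sum_(i <- s) h i x) =
  \sum_(i <- s) \int[mu]_(x in D) h i x.
Proof.
move=> mD hD; rewrite /Rintegral sum_fine; last first.
  by move=> i _; apply: integrable_fin_num => //; exact: hD.
by congr fine; under eq_integral do rewrite -sumEFin; exact: integral_sum.
Qed.

Lemma Rintegral_dist_le (R : realType) (X : ptopologicalType)
    (P : probability (borel X) R) (f g : X -> R) (e : R) :
  compact [set: X] -> continuous f -> continuous g ->
  (forall x, `|f x - g x| <= e) ->
  `|\int[P]_x f x - \int[P]_x g x| <= e.
Proof.
move=> cX cf cg fg.
have cB : continuous (fun x => f x - g x).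
  by move=> x; apply: cvgB; [exact: cf|exact: cg].
have intB := continuous_borel_integrable P cX cB.
rewrite -RintegralB//; [|exact: continuous_borel_integrable..].
apply: le_trans (le_normr_Rintegral _ intB) _ => //.
have -> : e = \int[P]_x (cst e x).
  rewrite Rintegral_cst// -[LHS]mulr1; congr (_ * _).
  exact: (congr1 fine (esym (probability_setT P))).
apply: le_Rintegral => //.
- apply: continuous_borel_integrable => // x.
  by apply: cvg_norm; exact: cB.
- by apply: continuous_borel_integrable => // x; exact: cst_continuous.
Qed.

(** * Finite codes for points and for measures of the shift *)

Section full_shift_measures.
Context (R : realType) (m : nat) (m_gt1 : (1 < m)%N).
Local Notation X := (full_shift m_gt1).
Local Notation word L := {ffun 'I_L -> alphabet m_gt1}.
Local Notation M := (borel_probability R X).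
Local Notation pr P A := (fine (sval P A)).

Definition extend (L : nat) (w : word L) : X :=
  fun i => if insub i is Some j then w j else point.

Lemma extendK (L : nat) : cancel (@extend L) (initial_word L).
Proof. by move=> w; apply/ffunP => i; rewrite ffunE /extend valK. Qed.

(** By compactness [x] has a limit along [U]; [y] shares it, since each coordinate eventually lies
    in the common prefix. So prefixes can serve as codes in [ultra_code_uniform]. *)
Lemma prefix_ultra (U : set_system nat) (x y : nat -> X) : UltraFilter U ->
  \oo `<=` U -> (forall L, initial_word L (x L) = initial_word L (y L)) ->
  exists z : X, x @ U --> z /\ y @ U --> z.
Proof.
move=> UU ooU xy.
have [z _ xz] := ultra_compact_cvg UU (@full_shift_compact _ m_gt1) (fun i => I)
  (x := x).
exists z; split => //; apply: full_shift_cvg => i.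
have Ui : U [set L | (i < L)%N] by apply: ooU; exists i.+1.
have Uxi : U [set L | x L i = z i] by exact: xz (near_coord z i).
apply: (filterS (F := U)) (filterI Ui Uxi) => L [/= iL <-].
by rewrite ((prefix_eqP _ _ _).1 (xy L)).
Qed.

(** Uniform continuity, from [ultra_code_uniform] for the pseudometric [|f x - f y|]. *)
Lemma continuous_prefix (f : X -> R) (e : R) : continuous f -> 0 < e ->
  exists L, forall x y, initial_word L x = initial_word L y -> `|f x - f y| < e.
Proof.
move=> cf; apply: (ultra_code_uniform prefix_ultra).
- by move=> x y; exact: distrC.
- by move=> x y z; exact: ler_distD.
- by move=> x; have /cvgrPdist_lt := cf x.
Qed.

(** Membership in a clopen set is locally constant, hence by compactness a function of finitely many
    coordinates. All levels [l] beyond [L] are covered because [measure_code] is used at varying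
    levels. *)
Lemma clopen_prefixE (A : set X) : clopen A ->
  exists L, forall l, (L <= l)%N ->
    A = initial_word l @^-1` [set` [set w : word l | extend w \in A]%SET].
Proof.
move=> [oA cA].
have nA x : \forall y \near x, (y \in A) = (x \in A).
  have [Ax|nAx] := pselect (A x).
    have : nbhs x A by exact: open_nbhs_nbhs.
    by apply: filterS => y Ay; rewrite !mem_set.
  have : nbhs x (~` A) by apply: open_nbhs_nbhs; split => //; exact: closed_openC.
  by apply: filterS => y Ay; rewrite !memNset.
pose rho (x y : X) : R := ((x \in A) != (y \in A))%:R.
have [L LP] : exists L, forall x y, initial_word L x = initial_word L y -> rho x y < 1.
  apply: (ultra_code_uniform prefix_ultra) => //.
  - by move=> x y; rewrite /rho eq_sym.
  - move=> x y z; rewrite /rho -natrD ler_nat.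
    by case: (x \in A); case: (y \in A); case: (z \in A).
  - move=> x e e0; apply: filterS (nA x) => y yx.
    by rewrite /rho yx eqxx.
exists L => l Ll; have mem_extend x : (extend (initial_word l x) \in A) = (x \in A).
  have : rho (extend (initial_word l x)) x < 1.
    apply: LP; apply/prefix_eqP => i iL.
    by apply: ((prefix_eqP l _ _).1 (extendK _)); exact: leq_trans Ll.
  by rewrite /rho; case: (_ =P _) => //= _; rewrite ltxx.
apply/seteqP; split => x /=; rewrite inE mem_extend; first exact: mem_set.
exact: set_mem.
Qed.

Lemma prefix_fun_continuous (L : nat) (T : topologicalType) (g : word L -> T) :
  continuous (fun x : X => g (initial_word L x)).
Proof.
move=> x A /nbhs_singleton Ax; have xFilter : Filter (nbhs x) by exact: nbhs_filter.
have : nbhs x [set y | initial_word L y = initial_word L x] by exact: near_prefix.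
by apply: filterS => y /= yx; rewrite /= yx.
Qed.

Lemma prefix_measurable (L : nat) (S : set (word L)) :
  measurable (initial_word L @^-1` S : set (borel X)).
Proof. by apply: sub_sigma_algebra; have [] := clopen_prefix S. Qed.

Lemma Rintegral_prefix (P : M) (L : nat) (g : word L -> R) :
  \int[sval P]_x g (initial_word L x) =
  \sum_w g w * pr P (initial_word L @^-1` [set w]).
Proof.
have gE x : g (initial_word L x) = \sum_w g w * \1_(initial_word L @^-1` [set w]) x.
  rewrite (bigD1 (initial_word L x)) //= indicE mem_set// mulr1 big1 ?addr0// => w wx.
  by rewrite indicE memNset ?mulr0//= => xw; rewrite xw eqxx in wx.
have intw (h : word L -> R) :
    (sval P).-integrable setT (EFin \o (fun x : borel X => h (initial_word L x))).
  apply: continuous_borel_integrable; first exact: full_shift_compact.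
  exact: prefix_fun_continuous.
under eq_Rintegral do rewrite gE.
rewrite Rintegral_sum//; last first.
  by move=> w; exact: (intw (fun v => g w * \1_[set w] v)).
apply: eq_bigr => w _; rewrite RintegralZl//; last exact: (intw \1_[set w]).
congr (_ * _); rewrite /Rintegral integral_indic ?setIT//; exact: prefix_measurable.
Qed.

(** Replaces [f] by the function constant on cylinders with value [f (extend w)]. *)
Lemma integral_prefix_approx (P : M) (L : nat) (f : X -> R) (e : R) :
  continuous f -> (forall x y, initial_word L x = initial_word L y -> `|f x - f y| < e) ->
  `|\int[sval P]_x f x -
    \sum_w f (extend w) * pr P (initial_word L @^-1` [set w])| <= e.
Proof.
move=> cf fe; rewrite -(Rintegral_prefix P (f \o @extend L)).
apply: Rintegral_dist_le => //; first exact: full_shift_compact.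
  exact: (@prefix_fun_continuous L R (f \o @extend L)).
by move=> x; apply/ltW/fe; rewrite /= extendK.
Qed.

(** A continuous [f] is uniformly close to a function of a prefix, whose integral is a finite
    combination of masses of clopen sets. *)
Lemma clopen_weak_cvg (I : Type) (F : set_system I) (P : I -> M) (Q : M) :
  Filter F ->
  (forall A, clopen A -> pr (P i) A @[i --> F] --> pr Q A) -> P @ F --> Q.
Proof.
move=> FF PQ; apply: weak_cvg => f; apply/cvgrPdist_lt => e e0.
(* Two approximation errors and the error of the finite sums, each at most [e / 4], stay below
   [e]. *)
have e4 : 0 < e / 4 by rewrite divr_gt0.
have [L fL] := continuous_prefix (@cts_fun _ _ f) e4.
have approx S := integral_prefix_approx S (@cts_fun _ _ f) fL.
have : \sum_w f (extend w) * pr (P i) (@initial_word _ m_gt1 L @^-1` [set w])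
    @[i --> F] -->
    \sum_w f (extend w) * pr Q (@initial_word _ m_gt1 L @^-1` [set w]).
  apply: cvg_big => [|w _]; first exact: add_continuous.
  by apply: cvgMr; apply: PQ; exact: clopen_prefix.
move=> /cvgrPdist_lt /(_ _ e4); apply: filterS => i.
have := approx (P i); have := approx Q.
set a := \int[_]_x _; set b := \int[_]_x _; set s := \sum_w _; set t := \sum_w _.
rewrite !ler_norml !ltr_norml => /andP[? ?] /andP[? ?] /andP[? ?].
apply/andP; split; lra.
Qed.

Lemma pr_itv (P : M) (A : set X) : 0 <= pr P A <= 1.
Proof.
have [mA|nA] := pselect (measurable (A : set (borel X))).
  rewrite fine_ge0//= -lee_fin fineK ?probability_le1//.
  exact: fin_num_measure.
by rewrite (svalP P)// lexx ler01.
Qed.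

(* Recording the masses of all unions of cylinders, not only of single cylinders,
   makes equal codes at level [L] agree within [1 / L] on every clopen set
   depending on the first [L] coordinates. *)
Definition measure_code (L : nat) (P : M) :
    {ffun {set word L} -> 'I_L.+1} :=
  [ffun S : {set word L} =>
    inord (Num.truncn (L%:R * pr P (initial_word L @^-1` [set` S])))].

(** Equal integer parts put both scaled masses in one unit interval. The product form makes sense at
    [L = 0]. *)
Lemma measure_code_dist (L : nat) (P Q : M) (S : {set word L}) :
  measure_code L P = measure_code L Q ->
  L%:R * `|pr P (initial_word L @^-1` [set` S]) -
           pr Q (initial_word L @^-1` [set` S])| <= 1.
Proof.
move=> /ffunP /(_ S); rewrite !ffunE => /(congr1 val) /=.
set p := pr P _; set q := pr Q _.
(* The integer part is at most [L], so [inord] does not fall back on its default. *)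
have codeL (x : R) : 0 <= x <= 1 -> (Num.truncn (L%:R * x) < L.+1)%N.
  move=> /andP[x0 x1]; rewrite ltnS Num.Theory.truncn_le_nat.
  by apply: (@le_lt_trans _ _ (L%:R * 1)); rewrite ?ler_wpM2l// mulr1 ltr_nat.
rewrite !inordK ?codeL ?pr_itv// => pq.
have /andP[p0 _] := pr_itv P (initial_word L @^-1` [set` S]).
have /andP[q0 _] := pr_itv Q (initial_word L @^-1` [set` S]).
have := Num.Theory.truncn_itv (mulr_ge0 (ler0n R L) p0).
have := Num.Theory.truncn_itv (mulr_ge0 (ler0n R L) q0).
rewrite -/p -/q -pq -natr1 => /andP[? ?] /andP[? ?].
rewrite -[X in X * _]ger0_norm// -normrM mulrBr ler_norml.
apply/andP; split; lra.
Qed.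

(** Masses converge set by set in [[0, 1]]; the limit is finitely additive on clopen sets, so
    [clopen_content_extension] realizes it there by a measure. *)
Lemma measure_ultralimit (I : Type) (U : set_system I) (P : I -> M) :
  UltraFilter U ->
  exists Q : M, forall A, clopen A -> pr (P i) A @[i --> U] --> pr Q A.
Proof.
move=> UU.
have /choice[nu nuP] (A : set X) :
    exists r : R, 0 <= r /\ pr (P i) A @[i --> U] --> r.
  have [|r] := @ultra_compact_cvg _ U R `[0, 1]%classic (fun i => pr (P i) A) UU
    (@segment_compact _ _ _).
    by move=> i; rewrite /= in_itv /= pr_itv.
  by rewrite /= in_itv /= => /andP[r0 _] cvr; exists r.
have [] := @clopen_content_extension R X nu (@full_shift_compact _ m_gt1)
  (@full_shift_open_sigma _ m_gt1).
- by move=> A; have [] := nuP A.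
- apply: (@cvg_unique _ (@Rhausdorff R) (pr (P i) setT @[i --> U])).
    by have [] := nuP setT.
  have -> : (fun i => pr (P i) setT) = cst 1.
    by apply/funext => i; exact: (congr1 fine (probability_setT (sval (P i)))).
  exact: cvg_cst.
- move=> A B [oA _] [oB _] AB.
  apply: (@cvg_unique _ (@Rhausdorff R) (pr (P i) (A `|` B) @[i --> U])).
    by have [] := nuP (A `|` B).
  have mA : measurable (A : set (borel X)) by exact: sub_sigma_algebra.
  have mB : measurable (B : set (borel X)) by exact: sub_sigma_algebra.
  have -> : (fun i => pr (P i) (A `|` B)) = (fun i => pr (P i) A + pr (P i) B).
    by apply/funext => i; rewrite measureU// fineD//; exact: fin_num_measure.
  by apply: cvgD; [have [] := nuP A|have [] := nuP B].
- move=> Q QE; exists Q => A cA; rewrite QE//=.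
  by have [] := nuP A.
Qed.

(** A limit [S] of [P] is also one of [Q]: at large levels a clopen set is a union of cylinders seen
    by the code, so its two masses differ by at most [1 / L]. *)
Lemma measure_code_ultra (U : set_system nat) (P Q : nat -> M) :
  UltraFilter U -> \oo `<=` U ->
  (forall L, measure_code L (P L) = measure_code L (Q L)) ->
  exists S : M, P @ U --> S /\ Q @ U --> S.
Proof.
move=> UU ooU PQ; have [S PS] := measure_ultralimit P UU.
exists S; split; first exact: clopen_weak_cvg.
apply: clopen_weak_cvg => A cA; apply/cvgrPdist_lt => e e0.
have e2 : 0 < e / 2 by rewrite divr_gt0.
have UP : U [set L | `|pr S A - pr (P L) A| < e / 2].
  by have /cvgrPdist_lt/(_ _ e2) := PS A cA.
have [l lA] := clopen_prefixE cA.
(* The level must reach [l] for the code to see [A], and exceed [2 / e] for [1 / L] to be below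
   [e / 2]. *)
have UL : U [set L | (maxn l (Num.truncn (e / 2)^-1).+1 <= L)%N].
  by apply: ooU; exists (maxn l (Num.truncn (e / 2)^-1).+1).
apply: (filterS (F := U)) (filterI UP UL) => L /= [SP].
rewrite geq_max => /andP[lL eL].
have := measure_code_dist [set w | extend w \in A]%SET (PQ L).
rewrite -(lA L lL) => PQA.
have L0 : 0 < L%:R :> R by rewrite ltr0n (leq_trans _ eL).
have : `|pr (P L) A - pr (Q L) A| < e / 2.
  rewrite -(ltr_pM2l L0) (le_lt_trans PQA)// -ltr_pdivrMr// mul1r.
  rewrite (lt_le_trans (Num.Theory.truncnS_gt _))//.
  by rewrite ler_nat.
move: SP; rewrite !ltr_norml => /andP[? ?] /andP[? ?].
apply/andP; split; lra.
Qed.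

End full_shift_measures.

(** * Dirac measures *)

(** The subtype condition fixes the values on nonmeasurable sets, so the set functions are equal;
    the remaining fields are proofs, identified by proof irrelevance. *)
Lemma borel_probability_ext (R : realType) (X : ptopologicalType)
    (P Q : borel_probability R X) :
  (forall A : set (borel X), measurable A -> sval P A = sval Q A) -> P = Q.
Proof.
case: P Q => [P P0] [Q Q0] /= PQ.
have {}PQ : (P : set (borel X) -> \bar R) = Q.
  apply/funext => A; have [/PQ//|nA] := pselect (measurable A).
  by rewrite P0// Q0.
suff PQE : P = Q.
  move: P0 Q0; rewrite {}PQE => P0 Q0.
  by rewrite (Prop_irrelevance P0 Q0).
case: P Q PQ {P0 Q0} => [p [[p1 p2] [p3] [p4] [p5] [p6] [p7] [p8]]].
case=> [q [[q1 q2] [q3] [q4] [q5] [q6] [q7] [q8]]] /= pq.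
subst q; rewrite (Prop_irrelevance q1 p1) (Prop_irrelevance q2 p2).
rewrite (Prop_irrelevance q3 p3) (Prop_irrelevance q4 p4).
rewrite (Prop_irrelevance q5 p5) (Prop_irrelevance q6 p6).
by rewrite (Prop_irrelevance q7 p7) (Prop_irrelevance q8 p8).
Qed.

Section dirac_embedding.
Context (R : realType) (X : ptopologicalType).

Definition borel_dirac (x : X) : borel_probability R X :=
  to_borel_probability (dirac (x : borel X)).

Lemma borel_diracE (x : X) (A : set (borel X)) : measurable A ->
  sval (borel_dirac x) A = \d_(x : borel X) A.
Proof. by move=> mA; rewrite /= borel_restrE. Qed.

Lemma Rintegral_borel_dirac (x : X) (f : X -> R) : continuous f ->
  \int[sval (borel_dirac x)]_y f y = f x.
Proof.
move=> cf; rewrite /Rintegral.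
rewrite (eq_measure_integral (\d_(x : borel X))); last first.
  by move=> A mA _; exact: borel_diracE.
rewrite integral_dirac//=; first by rewrite indicE in_setT mul1r.
exact: ((measurable_realfun.measurable_EFinP _ _).2
  (continuous_borel_measurable cf)).
Qed.

Lemma borel_dirac_continuous : continuous borel_dirac.
Proof.
move=> x; apply: weak_cvg => f; rewrite Rintegral_borel_dirac; last exact: cts_fun.
have -> : (fun y => \int[sval (borel_dirac y)]_z f z) = f.
  by apply/funext => y; rewrite Rintegral_borel_dirac//; exact: cts_fun.
exact: cts_fun.
Qed.

Lemma image_measure_dirac (T : continuousType X X) (x : X) :
  image_measure T (borel_dirac x) = borel_dirac (T x).
Proof.
apply: borel_probability_ext => A mA; rewrite image_measureE// !borel_diracE//.
have := @borel_map_measurable X T measurableT A mA.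
by rewrite setTI.
Qed.

End dirac_embedding.

(** * Separation numbers and the order scaling *)

Section capacity_bounds.
Context (R : realType) (X : choiceType).
Variables (d : X -> X -> R) (T : X -> X).

(** The codes along an orbit segment of length [n] form a word over [K]; points with the same word
    are at Bowen distance less than [e], so [F] injects into the words. *)
Lemma max_separated_le (K : finType) (c : X -> K) (n : nat) (e : R) :
  0 < e -> (forall x y, c x = c y -> d x y < e) ->
  (max_separated d T n e <= (#|K| ^ n)%:R%:E)%E.
Proof.
move=> e0 cd; apply: ge_ereal_sup => _ [F sepF <-].
rewrite lee_fin ler_nat -[X in (_ <= _ ^ X)%N](card_ord n) -card_ffun.
pose code x := [ffun j : 'I_n => c (iter j T x)].
rewrite -(size_map code) -(card_uniqP _) ?max_card//.
rewrite map_inj_in_uniq ?fset_uniq// => x y xF yF xy.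
apply: contrapT => /eqP /(sepF x y xF yF); apply/negP; rewrite -ltNge.
apply: bigmax_lt => // j _; apply: cd.
by move/ffunP : xy => /(_ j); rewrite !ffunE.
Qed.

Lemma max_separated_ge0 (n : nat) (e : R) : (0 <= max_separated d T n e)%E.
Proof.
by apply: ereal_sup_ubound; exists fset0; rewrite ?cardfs0// => x y; rewrite inE.
Qed.

Lemma max_separated_nonincreasing (n : nat) (e e' : R) : e <= e' ->
  (max_separated d T n e' <= max_separated d T n e)%E.
Proof.
move=> ee'; apply: le_ereal_sup => _ [F sepF <-]; exists F => // x y xF yF xy.
exact: le_trans ee' (sepF x y xF yF xy).
Qed.

Lemma order_sclE (a : R) (n : nat) :
  order_scl a (expR (- n%:R)) = expR (- (n%:R `^ a)).
Proof. by rewrite /order_scl -expRN opprK expRK. Qed.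

Lemma cvgn_powRy (a : R) : 0 < a -> n%:R `^ a @[n --> \oo] --> +oo.
Proof.
move=> a0; apply/cvgryPge => A.
near=> n; apply: (le_trans (ler_norm A)).
have -> : `|A| = (`|A| `^ a^-1) `^ a by rewrite -powRrM mulVf ?gt_eqF// powRr1.
apply: ge0_ler_powR; rewrite ?nnegrE ?powR_ge0 ?(ltW a0)//.
by near: n; exact: nbhs_infty_ger.
Unshelve. all: by end_near. Qed.

(** Since [N <= exp N], the sequence is at most [exp (N n - n^a)], which is eventually at most
    [exp (- n)]: as [a > 1], [n^(a - 1)] passes [N + 1]. *)
Lemma upper_capacity_at0 (a : R) : 1 < a ->
  (forall e, 0 < e -> exists N : nat, forall n,
    (max_separated d T n e <= (N ^ n)%:R%:E)%E) ->
  upper_capacity_at d T (@order_scl R) a = 0%E.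
Proof.
move=> a1 sepN; apply/cvg_lim => //; apply: cvg_near_cst.
near=> e; have [|N sepNe] := sepN e; first by near: e; exact: nbhs_right_gt.
apply: (cvg_limn_einf_sup _).2.
apply: (@squeeze_cvge _ _ _ _ (cst 0%E) _ (fun n => (expR (- n%:R))%:E)).
- near=> n; apply/andP; split.
    by rewrite mule_ge0 ?max_separated_ge0// lee_fin expR_ge0.
  rewrite order_sclE.
  apply: (@le_trans _ _ ((N ^ n)%:R%:E * (expR (- (n%:R `^ a)))%:E)%E).
    by rewrite lee_wpmul2r// lee_fin expR_ge0.
  rewrite -EFinM lee_fin natrX.
  apply: (@le_trans _ _ (expR N%:R ^+ n * expR (- (n%:R `^ a)))).
    rewrite ler_wpM2r ?expR_ge0// lerXn2r ?nnegrE ?expR_ge0//.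
    by apply: le_trans (expR_ge1Dx _); rewrite lerDr.
  rewrite -expRM_natl -expRD ler_expR -mulr_powRB1// ?(lt_trans ltr01)//.
  have : N%:R + 1 <= n%:R `^ (a - 1).
    near: n; have := @cvgn_powRy (a - 1).
    by rewrite subr_gt0 => /(_ a1) /cvgryPge; exact.
  move=> /(ler_wpM2l (ler0n R n)); rewrite mulrDr mulr1; lra.
- exact: cvg_cst.
- apply: cvg_EFin; first exact: nearW.
  exact: cvgn_expR.
Unshelve. all: by end_near. Qed.

(** The lower bound passes to all smaller scales, and the sequence is then at least
    [exp (n / 2 - n^a)], which diverges because [a < 1]. *)
Lemma upper_capacity_aty (a : R) : 0 < a < 1 ->
  (exists2 e, 0 < e & forall n, ((2 ^ n)%:R%:E <= max_separated d T n e)%E) ->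
  upper_capacity_at d T (@order_scl R) a = +oo%E.
Proof.
move=> /andP[a0 a1] [e0 e00 sep2]; apply/cvg_lim => //; apply: cvg_near_cst.
near=> e; apply: (cvg_limn_einf_sup _).2.
apply: (@gee_cvgy _ _ _ _ (fun n => (n%:R / 4)%:E)); last first.
  apply/cvgeryP/cvgryPge => A; near=> n; rewrite ler_pdivlMr//.
  by near: n; exact: nbhs_infty_ger.
near=> n; rewrite order_sclE.
apply: (@le_trans _ _ ((2 ^ n)%:R%:E * (expR (- (n%:R `^ a)))%:E)%E); last first.
  rewrite lee_wpmul2r ?lee_fin ?expR_ge0//.
  apply: le_trans (sep2 n) (max_separated_nonincreasing _ _).
  by near: e; exact: nbhs_right_le.
rewrite -EFinM lee_fin natrX.
(* From [exp (- 1 / 2) >= 1 - 1 / 2]. *)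
have exp2 : expR (2^-1) <= 2 :> R.
  rewrite -[leLHS]invrK -expRN -[leRHS]invrK lef_pV2 ?posrE ?expR_gt0 ?invr_gt0//.
  by apply: le_trans (expR_ge1Dx _); lra.
apply: (@le_trans _ _ (expR (2^-1) ^+ n * expR (- (n%:R `^ a)))); last first.
  by rewrite ler_wpM2r ?expR_ge0// lerXn2r ?nnegrE ?expR_ge0.
rewrite -expRM_natl -expRD; apply: le_trans (expR_ge1Dx _).
(* The constant 4 gives [n^a <= n / 4], so [1 + n / 2 - n^a] is at least [n / 4]. *)
have : 4 <= n%:R `^ (1 - a) :> R.
  near: n; have := @cvgn_powRy (1 - a).
  by rewrite subr_gt0 => /(_ a1) /cvgryPge; exact.
move=> /(ler_wpM2l (powR_ge0 n%:R a)).
rewrite -powRD ?subrKC ?oner_eq0// powRr1//; lra.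
Unshelve. all: by end_near. Qed.

(** Exponents above 1 give capacity 0 and positive exponents below 1 give infinite capacity, so the
    infimum is 1 whatever happens at 1 itself. *)
Lemma upper_capacity_scale1 :
  (forall e, 0 < e -> exists N : nat, forall n,
    (max_separated d T n e <= (N ^ n)%:R%:E)%E) ->
  (exists2 e, 0 < e & forall n, ((2 ^ n)%:R%:E <= max_separated d T n e)%E) ->
  upper_capacity_scale d T (@order_scl R) = 1%E.
Proof.
move=> le_sep ge_sep; apply/eqP; rewrite eq_le; apply/andP; split.
  apply/lee_addgt0Pr => e e0; apply: ereal_inf_lbound; exists (1 + e) => //.
  split; first by rewrite addr_gt0.
  by apply: upper_capacity_at0 => //; rewrite ltrDl.
apply: le_ereal_inf_tmp => _ [a [a0 capa] <-]; rewrite lee_fin leNgt.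
apply/negP => a1; move: capa.
by rewrite upper_capacity_aty// a0.
Qed.

End capacity_bounds.

(** * Separation by first symbols, and application to both systems *)

Section symbolic_separation.
Context (R : realType) (m : nat) (m_gt1 : (1 < m)%N).
Local Notation X := (full_shift m_gt1).

(** Distinct words differ at some [i < n], and [i] shifts bring that symbol to position 0, where the
    images are [e] apart. The words number [m ^ n], at least [2 ^ n]. *)
Lemma factor_max_separated_ge (Y : choiceType) (D : Y -> Y -> R) (T : Y -> Y)
    (g : X -> Y) (e : R) :
  0 < e -> (forall y, D y y = 0) ->
  (forall x, T (g x) = g (left_shift x)) ->
  (forall x y : X, x 0%N != y 0%N -> e <= D (g x) (g y)) ->
  forall n, ((2 ^ n)%:R%:E <= max_separated D T n e)%E.
Proof.
move=> e0 D0 Tg sepD n.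
have iterT j x : iter j T (g x) = g (fun i => x (j + i)%N).
  elim: j => [//|j IH]; rewrite /= IH Tg; congr g.
  by apply/funext => i; rewrite /left_shift addnS.
pose ext := @extend m m_gt1 n.
have sepw (v w : {ffun 'I_n -> alphabet m_gt1}) : v != w ->
    e <= bowen_dist D T n (g (ext v)) (g (ext w)).
  move=> vw; have [i vwi] : exists i, v i != w i.
    apply: contrapT => /forallNP vwE; move: vw => /eqP; apply; apply/ffunP => i.
    by have /negP/negPn/eqP := vwE i.
  apply: le_trans (le_bigmax _ _ i); rewrite !iterT; apply: sepD.
  by rewrite addn0 /ext /extend !valK.
(* Equal images would have Bowen distance 0, below [e]. *)
have injg : injective (g \o ext).
  move=> v w /= gvw; apply/eqP/negP => /negP /sepw; rewrite gvw.
  rewrite leNgt => /negP; apply; apply: bigmax_lt => // i _.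
  by rewrite D0.
have card_words : #|{ffun 'I_n -> alphabet m_gt1}| = (m ^ n)%N.
  by rewrite card_ffun card_ord; congr (_ ^ _)%N; exact: card_ord.
apply: (@le_trans _ _ (#|{ffun 'I_n -> alphabet m_gt1}|%:R)%:E).
  rewrite lee_fin ler_nat card_words; elim: (n) => // k IH.
  by rewrite !expnS leq_mul.
apply: ereal_sup_ubound.
exists [fset (g \o ext) w | w in {ffun 'I_n -> alphabet m_gt1}]%fset.
  move=> _ _ /imfsetP[v _ ->] /imfsetP[w _ ->] vw; apply: sepw.
  by apply: contraNneq vw => ->.
by rewrite card_imfset//= cardE.
Qed.

(** Otherwise pairs with different first symbols have images at distance tending to 0. Along an
    ultrafilter both images tend to the same [g z], so both first symbols eventually equal that of
    [z]. *)
Lemma embedding_separated (Y : topologicalType) (D : Y -> Y -> R) (g : X -> Y) :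
  compatible_metric D -> continuous g ->
  (forall b, exists2 V, open V & g @^-1` V = [set x | x 0%N = b]) ->
  exists2 e, 0 < e & forall x y : X, x 0%N != y 0%N -> e <= D (g x) (g y).
Proof.
move=> [_ _ D_tri DN] cg gV; apply: contrapT => nsep.
have /choice[xy xyP] (k : nat) :
    exists xy : X * X, xy.1 0%N != xy.2 0%N /\ D (g xy.1) (g xy.2) < k.+1%:R^-1.
  apply: contrapT => /forallNP nk; apply: nsep.
  exists k.+1%:R^-1; rewrite ?invr_gt0// => x y xy.
  rewrite leNgt; apply/negP => Dxy.
  by apply: (nk (x, y)).
have [U [UU ooU]] := ultraFilterLemma (eventually_filter).
have [z _ xz] := ultra_compact_cvg UU (@full_shift_compact _ m_gt1) (fun i => I)
  (x := fst \o xy).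
have [V oV gVE] := gV (z 0%N).
have : nbhs (g z) V.
  by apply: open_nbhs_nbhs; split => //; rewrite -[V _]/((g @^-1` V) z) gVE.
rewrite DN => -[r /= r0 rV].
have r2 : 0 < r / 2 by rewrite divr_gt0.
have Ux : U [set k | (xy k).1 0%N = z 0%N] by exact: xz (near_coord z 0%N).
have UD : U [set k | D (g z) (g (xy k).1) < r / 2].
  apply: (xz [set x | D (g z) (g x) < r / 2]).
  by apply: (cg z [set y | D (g z) y < r / 2]); rewrite DN; exists (r / 2).
have Uk : U [set k | k.+1%:R^-1 < r / 2].
  by apply: ooU; exact: near_infty_natSinv_lt (PosNum r2).
have [k [[/= xk Dk] rk]] := filter_ex (filterI (filterI Ux UD) Uk).
have [xyk Dxy] := xyP k.
have : (g @^-1` V) (xy k).2.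
  apply: rV; rewrite /= (splitr r).
  exact: le_lt_trans (D_tri _ _ _) (ltrD Dk (lt_trans Dxy rk)).
by rewrite gVE /= => yk; rewrite xk yk eqxx in xyk.
Qed.

End symbolic_separation.

(** [ultra_code_uniform] applied to [d] gives a level [L] whose codes determine points up to [e];
    [N] is the number of these codes. *)
Lemma compatible_metric_code (R : realType) (X : topologicalType)
    (d : X -> X -> R) (T : X -> X) (K : nat -> finType) (c : forall L, X -> K L) :
  compatible_metric d ->
  (forall (U : set_system nat) (x y : nat -> X), UltraFilter U ->
    \oo `<=` U -> (forall L, c L (x L) = c L (y L)) ->
    exists z : X, x @ U --> z /\ y @ U --> z) ->
  forall e, 0 < e -> exists N : nat, forall n,
    (max_separated d T n e <= (N ^ n)%:R%:E)%E.
Proof.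
move=> [_ d_sym d_tri dN] cU e e0.
have [|L cL] := ultra_code_uniform cU d_sym d_tri _ e0.
  move=> x r r0; suff: nbhs x [set y | d x y < r] by [].
  by rewrite dN; exists r.
by exists #|K L| => n; exact: (max_separated_le T n e0 cL).
Qed.

Lemma embedding_capacity_ge (R : realType) (m : nat) (m_gt1 : (1 < m)%N)
    (Y : topologicalType) (D : Y -> Y -> R) (T : Y -> Y)
    (g : full_shift m_gt1 -> Y) :
  compatible_metric D -> continuous g ->
  (forall b, exists2 V, open V & g @^-1` V = [set x | x 0%N = b]) ->
  (forall x, T (g x) = g (left_shift x)) ->
  exists2 e, 0 < e & forall n, ((2 ^ n)%:R%:E <= max_separated D T n e)%E.
Proof.
move=> hD cg gV Tg; have [e e0 sepD] := embedding_separated hD cg gV.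
exists e => //; apply: (factor_max_separated_ge e0 _ Tg sepD) => y.
by have [D0 _ _ _] := hD; apply/D0.
Qed.

Lemma open_coord (m : nat) (m_gt1 : (1 < m)%N) (b : alphabet m_gt1) :
  open [set x : full_shift m_gt1 | x 0%N = b].
Proof.
rewrite openE => x /= xb; have xF : Filter (nbhs x) by exact: nbhs_filter.
by apply: filterS (near_coord x 0%N) => y /= ->.
Qed.

(** [V] consists of the measures giving positive integral to the indicator of the cylinder of [b],
    which is continuous since the cylinder is clopen; a Dirac measure integrates it to 0 or 1. *)
Lemma dirac_open_coord (R : realType) (m : nat) (m_gt1 : (1 < m)%N)
    (b : alphabet m_gt1) :
  exists2 V, open V &
    @borel_dirac R (full_shift m_gt1) @^-1` V = [set x | x 0%N = b].
Proof.
pose X := full_shift m_gt1.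
pose f (x : X) : R := (initial_word 1 x ord0 == b)%:R.
have cf : continuous f.
  exact: (prefix_fun_continuous (g := fun w => (w ord0 == b)%:R : R)).
pose F : continuousType X R :=
  HB.pack_for (continuousType X R) f (isContinuous.Build _ _ f cf).
exists [set P : borel_probability R X | 0 < \int[sval P]_x F x].
  apply: (open_comp (f := fun P : borel_probability R X => \int[sval P]_x F x)
    (D := [set r | 0 < r])).
    by move=> P _; exact: integration_continuous.
  exact: open_gt.
apply/seteqP; split => x /=; rewrite Rintegral_borel_dirac// /F/= /f ffunE/=.
  by case: eqP => //; rewrite ltxx.
by move=> ->; rewrite eqxx.
Qed.

Theorem proposition5p8 (R : realType) (m : nat) (m_ge2 : (2 <= m)%N)
    (d : full_shift m_ge2 -> full_shift m_ge2 -> R)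
    (hd : compatible_metric d)
    (D : borel_probability R (full_shift m_ge2) ->
         borel_probability R (full_shift m_ge2) -> R)
    (hD : compatible_metric D) :
  let h_shift :=
    upper_capacity_scale d (@left_shift m m_ge2) (@order_scl R) in
  let h_induced :=
    upper_capacity_scale D (@image_measure R _ (@left_shift m m_ge2))
      (@order_scl R) in
  [/\ h_shift = 1%E, h_induced = 1%E & (0 < h_induced < +oo)%E].
Proof.
move=> h_shift h_induced.
have h1 : h_shift = 1%E.
  apply: upper_capacity_scale1.
    exact: (compatible_metric_code _ hd (@prefix_ultra m m_ge2)).
  apply: (embedding_capacity_ge (g := id) hd) => // [x|b]; first by [].
  by exists [set x | x 0%N = b]; first exact: open_coord.
have h2 : h_induced = 1%E.
  apply: upper_capacity_scale1.
    exact: (compatible_metric_code _ hD (@measure_code_ultra R m m_ge2)).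
  apply: (embedding_capacity_ge (g := @borel_dirac R _) hD).
  - exact: borel_dirac_continuous.
  - exact: dirac_open_coord.
  - by move=> x; exact: image_measure_dirac.
by split; rewrite // h2 ltry lte_fin ltr01.
Qed.
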